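(* Let $(U_n)_{n\ge0}$ be a VLMC defined by a probabilized infinite comb, with data $q_{0^\infty}$ and $q_{0^n1}$, $n\ge0$ (probability measures on $\{0,1\}$). Let $c_0=1$ and $c_n=\prod_{k=0}^{n-1}q_{0^k1}(0)$ for $n\ge1$. Consider, for a probability measure $\pi$ on $\mathcal L$, the formulae (F1) $\pi(10^n)=\pi(1)c_n$ for all $n\ge0$; (F2) $\pi(0^n)=1-\pi(1)\sum_{k=0}^{n-1}c_k$ for all $n\ge0$; (F3) $\pi(w)=\prod_{k=0}^{N-1}q_{\mathrm{pref}(\alpha_1\cdots\alpha_k)}(\alpha_{k+1})$ for every finite word $w=\alpha_1\cdots\alpha_N$. **(i) Irreducible case.** Assume $q_{0^\infty}(0)\ne1$. (i.a) The Markov process $(U_n)_{n\ge0}$ admits a stationary probability measure on $\mathcal L$ if and only if the series $\sum c_n$ converges. (i.b) Assume that $\sum c_n$ converges and let $S(1)=\sum_{n\ge0}c_n$. Then the stationary probability measure $\pi$ on $\mathcal L$ is unique; it is characterized by $\pi(1)=\frac1{S(1)}$ and formulae (F1), (F2), (F3). Furthermore, $\pi$ is trivial if and only if $q_1(0)=0$, in which case it is defined by $\pi(1^\infty)=1$. **(ii) Reducible case.** Assume $q_{0^\infty}(0)=1$. (ii.a) If $\sum c_n$ diverges, then the trivial probability measure $\pi$ on $\mathcal L$ defined by $\pi(0^\infty)=1$ is the unique stationary probability measure. (ii.b) If $\sum c_n$ converges, with sum $S(1)$, then there is a one-parameter family of stationary probability measures on $\mathcal L$: for any $a\in[0,1]$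 there exists a unique stationary probability measure $\pi_a$ on $\mathcal L$ such that $\pi_a(0^\infty)=a$. The measure $\pi_a$ is characterized by $\pi_a(1)=\frac{1-a}{S(1)}$ and formulae (F1), (F2), (F3). Furthermore, $\pi_a$ is nontrivial except in the two following cases: $a=1$, in which case $\pi_1$ is defined by $\pi_1(0^\infty)=1$; and $a=0$ and $q_1(0)=0$, in which case $\pi_0$ is defined by $\pi_0(1^\infty)=1$.
   Context: **Words.** $\mathcal A=\{0,1\}$; $\mathcal W$ is the set of finite words over $\mathcal A$ ($\emptyset$ is the empty word); $\mathcal L=\mathcal A^{-\mathbb N}$ is the set of left-infinite sequences $\cdots\alpha_{-1}\alpha_0$. $\overline w$ is the reversed word of $w$; for $s=\cdots\alpha_{-1}\alpha_0\in\mathcal L$, $\overline s=\alpha_0\alpha_{-1}\cdots$. For $w\in\mathcal W$, $\mathcal Lw$ is the set of $s\in\mathcal L$ having $w$ as a suffix; $\mathcal L$ carries the $\sigma$-algebra generated by these cylinders. For a probability measure $\pi$ on $\mathcal L$ and $w\in\mathcal W$, $\pi(w):=\pi(\mathcal Lw)$ (so $\pi(\emptyset)=1$). $\pi(0^\infty)$ and $\pi(1^\infty)$ denote the masses of the constant left-infinite sequences $\cdots000$ and $\cdots111$. **Infinite comb.** It is the tree $\mathcal T=\{0^n:n\ge0\}\cup\{0^n1:n\ge0\}$. Its internal nodes are the words $0^n$, $n\ge0$; its leaves (contexts) are the finite words $0^n1$, $n\ge0$, and the infinite word $0^\infty=000\cdots$. It is probabilized by a family of probability measures $q_c$ on $\mathcal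 A$ indexed by the contexts. **VLMC.** For $s\in\mathcal L$, $\mathrm{pref}(s)$ is the unique context that is a prefix of $\overline s$ (or equals $\overline s$). The VLMC is the $\mathcal L$-valued Markov chain $(U_n)$ with transitions $\mathbf P(U_{n+1}=U_n\alpha\mid U_n)=q_{\mathrm{pref}(U_n)}(\alpha)$, $\alpha\in\mathcal A$; a stationary probability measure is an invariant probability measure on $\mathcal L$ of this chain. **Prefix function on words and extended $q$.** For a finite word $w$: if $\overline w\in\mathcal T$, $\mathrm{pref}(w)=\overline w$; otherwise $\mathrm{pref}(w)$ is the unique finite context $c$ such that $\overline c$ is a suffix of $w$. For an internal node $u$, $q_u(\alpha):=\pi(\overline u\alpha)/\pi(\overline u)$ if $\pi(\overline u)\ne0$, and $q_u(\alpha):=0$ if $\pi(\overline u)=0$. In (F3), for $k=0$ the word $\alpha_1\cdots\alpha_k$ is $\emptyset$, $\mathrm{pref}(\emptyset)=\emptyset$ and $q_\emptyset(\alpha)=\pi(\alpha)$. **Trivial** means concentrated on a single sequence (a Dirac measure). *)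

(* Defs.v *)
From HB Require Import structures.
From mathcomp Require Import all_boot all_order all_algebra.
From mathcomp Require Import all_classical all_reals all_analysis.
From mathcomp Require Import measurable_realfun.

Set Implicit Arguments.
Unset Strict Implicit.
Unset Printing Implicit Defensive.
Import Order.TTheory GRing.Theory Num.Theory.
Import numFieldNormedType.Exports.

Local Open Scope classical_set_scope.
Local Open Scope ring_scope.

(* The letter 0 is [false] and the letter 1 is [true]. *)
Definition word := seq bool.

(* A left-infinite sequence s = ... a_(-1) a_0 is encoded by n |-> a_(-n), so
   that the underlying function is the reversed sequence a_0 a_(-1) ...;
   [reads u s] says that the word u is a prefix of that reversed sequence. *)
Definition reads (u : word) (s : nat -> bool) : Prop := mkseq s (size u) = u.

Definition cylinder (w : word) : set (nat -> bool) := [set s | reads (rev w) s].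

Definition leftseq := g_sigma_algebraType (range cylinder).

(* [snoc s a] is the left-infinite sequence s a. *)
Definition snoc (s : leftseq) (a : bool) : leftseq :=
  fun n => if n is m.+1 then s m else a.

Definition constseq (a : bool) : leftseq := fun=> a.

Definition leaf (n : nat) : word := rcons (nseq n false) true.

Definition comb : set word :=
  [set nseq n false | n in [set: nat]] `|` [set leaf n | n in [set: nat]].

(* [Some n] is the finite context 0^n 1 and [None] is the context 0^oo. *)
Definition context := option nat.

Definition context_reads (c : context) (s : leftseq) : Prop :=
  if c is Some n then reads (leaf n) s else s = constseq false.

Definition pref (s : leftseq) : context := xget None [set c | context_reads c s].

Definition pref_word (w : word) : word :=
  if rev w \in comb then rev w
  else xget [::] [set c | (exists n, c = leaf n) /\ suffix (rev c) w].

Lemma mkseq_leaf (s : nat -> bool) n :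
  mkseq s n.+1 = leaf n <-> s n = true /\ forall k, (k < n)%N -> s k = false.
Proof.
rewrite /leaf mkseqS; split.
  move=> /rcons_inj[h1 h2]; split=> // k kn.
  by rewrite -(nth_mkseq true s kn) h1 nth_nseq kn.
move=> [-> h]; congr rcons; apply: (@eq_from_nth _ true).
  by rewrite size_mkseq size_nseq.
by move=> i; rewrite size_mkseq => ni; rewrite nth_mkseq// nth_nseq ni h.
Qed.

Lemma reads_leaf n s :
  reads (leaf n) s <-> s n = true /\ forall k, (k < n)%N -> s k = false.
Proof. by rewrite /reads size_rcons size_nseq mkseq_leaf. Qed.

Lemma context_reads_uniq s c d : context_reads c s -> context_reads d s -> c = d.
Proof.
case: c d => [n|] [m|] //=.
- move=> /reads_leaf[sn hn] /reads_leaf[sm hm]; congr Some.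
  by case: (ltngtP n m) => [/hm|/hn|//]; rewrite ?sn ?sm.
- by move=> /reads_leaf[sn _] s0; move: sn; rewrite s0.
- by move=> s0 /reads_leaf[sn _]; move: sn; rewrite s0.
Qed.

Lemma prefP s : context_reads (pref s) s.
Proof.
suff [c hc] : exists c, context_reads c s by rewrite /pref; case: xgetP => // /(_ c).
have [[n sn]|s0] := pselect (exists n, s n).
  exists (Some (ex_minn (ex_intro _ n sn))) => /=; case: ex_minnP => m sm hm.
  apply/reads_leaf; split=> // k km; apply: contraTF km => sk.
  by rewrite -leqNgt hm.
exists None; apply/funext => n; apply/negbTE/negP => sn; exact: (s0 (ex_intro _ n sn)).
Qed.

Lemma pref_eq s c : context_reads c s -> pref s = c.
Proof. by move=> /(context_reads_uniq (prefP s)). Qed.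

Lemma suffix_leaf_uniq w n m :
  suffix (rev (leaf n)) w -> suffix (rev (leaf m)) w -> n = m.
Proof.
rewrite -[w]revK !suffix_rev => /prefixP[u hu] /prefixP[v hv].
have H k t : index true (leaf k ++ t) = k.
  by rewrite /leaf cat_rcons index_cat mem_nseq andbF size_nseq /= addn0.
by rewrite -(H n u) -hu hv H.
Qed.

Lemma suffix_leaf_ex w : rev w \notin comb -> exists n, suffix (rev (leaf n)) w.
Proof.
rewrite -{2}[w]revK; move: (rev w) => v vT.
exists (index true v); rewrite suffix_rev.
have tv : true \in v.
  apply: contraNT vT => tv; rewrite inE /comb; left; exists (size v) => //.
  by apply/esym/all_pred1P/allP => -[] // /(negP tv).
apply/prefixP; exists (drop (index true v).+1 v).
rewrite -{1}(cat_take_drop (index true v) v) (drop_nth true) ?index_mem//.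
rewrite nth_index// /leaf cat_rcons; congr (_ ++ _).
apply: (@eq_from_nth _ true); rewrite size_takel ?index_size// ?size_nseq//.
by move=> i iv; rewrite nth_nseq iv nth_take//; apply/negbTE/negP => /eqP;
  rewrite -[_ == _]/(pred1 true _) (before_find true iv).
Qed.

Lemma pref_wordP w :
  if rev w \in comb then pref_word w = rev w
  else exists n, pref_word w = leaf n /\ suffix (rev (leaf n)) w.
Proof.
rewrite /pref_word; case: (boolP (rev w \in comb)) => [//|wT]; have [n nw] := suffix_leaf_ex wT.
case: xgetP => [c _ [[m ->] mw]|/(_ (leaf n))]; first by exists m.
by case; split => //; exists n.
Qed.

Lemma measurable_cylinder w : measurable (cylinder w : set leftseq).
Proof. by apply: sub_sigma_algebra; exists w. Qed.

Lemma measurable_coord n b : measurable [set s : leftseq | s n = b].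
Proof.
pose W := [set w : word | size w = n.+1 /\ nth true (rev w) n = b].
rewrite (_ : [set s | _] = \bigcup_(w in W) cylinder w).
  rewrite bigcup_mkcond; apply: countable_bigcupT_measurable; first exact: countableP.
  by move=> w; case: ifP => // _; exact: measurable_cylinder.
apply/seteqP; split => s /=.
  move=> sn; exists (rev (mkseq s n.+1)) => /=.
    by rewrite /W /= size_rev size_mkseq revK nth_mkseq.
  by rewrite /cylinder /reads /= revK size_mkseq.
move=> [w [sw <-]]; rewrite /cylinder /reads /= => <-.
by rewrite size_rev sw nth_mkseq.
Qed.

Lemma cylinder_snoc w b s a :
  cylinder (rcons w b) (snoc s a) <-> a = b /\ cylinder w s.
Proof.
have H n : mkseq (snoc s a) n.+1 = a :: mkseq s n.
  by rewrite /mkseq /= -[1%N]addn0 iotaDl -map_comp.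
by rewrite /cylinder /= /reads rev_rcons H; split=> [[]|[-> ->]].
Qed.

Lemma measurable_snoc a : measurable_fun [set: leftseq] (snoc ^~ a).
Proof.
apply: (@measurability _ _ leftseq leftseq _ _ (range cylinder)) => //.
move=> _ [_ [w _ <-] <-]; rewrite setTI.
case/lastP: w => [|w b].
  rewrite (_ : _ @^-1` _ = [set: leftseq]); first exact: measurableT.
  by apply/seteqP; split.
have [->|ab] := eqVneq a b.
  rewrite (_ : _ @^-1` _ = cylinder w); first exact: measurable_cylinder.
  by apply/seteqP; split => s; [move=> /cylinder_snoc[]|
    move=> ws; apply/cylinder_snoc].
rewrite (_ : _ @^-1` _ = set0); first exact: measurable0.
by apply/seteqP; split => // s /cylinder_snoc[]/eqP; rewrite (negbTE ab).
Qed.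

Lemma measurable_pref (c : context) : measurable (pref @^-1` [set c]).
Proof.
rewrite (_ : _ @^-1` _ = [set s | context_reads c s]); last first.
  by apply/seteqP; split => s /=; [move=> <-; exact: prefP|exact: pref_eq].
case: c => [n|].
  rewrite (_ : [set _ | _] = cylinder (rev (leaf n))).
    exact: measurable_cylinder.
  by rewrite /cylinder revK.
rewrite (_ : [set _ | _] = \bigcap_n [set s : leftseq | s n = false]).
  by apply: bigcap_measurable => // n _; exact: measurable_coord.
apply/seteqP; split => s /=; first by move=> ->.
by move=> h; apply/funext => n; exact: h.
Qed.

Lemma snoc_measurable s : measurable_fun [set: bool] (snoc s).
Proof. by []. Qed.

HB.instance Definition _ (s : leftseq) :=
  isMeasurableFun.Build _ _ _ _ (snoc s) (@snoc_measurable s).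

Section vlmc.
Context {R : realType} (q : context -> probability bool R).

(* From s the chain moves to s a with a drawn according to q_(pref s). *)
Definition vlmc (s : leftseq) : {measure set leftseq -> \bar R} :=
  distribution (q (pref s)) (snoc s).

Let measurable_vlmc B : measurable B -> 
    measurable_fun [set: leftseq] (fun s => vlmc s B).
Proof.
move=> mB _ Y _; rewrite setTI.
pose val (t : context * bool * bool) :=
  q t.1.1 [set a | if a then t.2 else t.1.2].
pose E (t : context * bool * bool) := [set s : leftseq | [/\ pref s = t.1.1,
  (snoc s false \in B) = t.1.2 & (snoc s true \in B) = t.2]].
have vE s t : E t s -> vlmc s B = val t.
  case: t => [[c b0] b1] [/= <- <- <-].
  rewrite /vlmc /distribution /pushforward /val /=.
  by congr (q _ _); apply/seteqP; split => -[] /=; rewrite inE.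
have mE t : measurable (E t).
  have mS a b : measurable [set s | (snoc s a \in B) = b].
    have mSB : measurable ((snoc ^~ a) @^-1` B).
      by rewrite -[X in measurable X]setTI; exact: measurable_snoc.
    case: b.
      rewrite (_ : [set _ | _] = (snoc ^~ a) @^-1` B)//.
      by apply/seteqP; split => s /=; [exact: set_mem|exact: mem_set].
    rewrite (_ : [set _ | _] = ~` ((snoc ^~ a) @^-1` B)); first exact: measurableC.
    by apply/seteqP; split => s /=; [move/negbT; rewrite notin_setE|
      move=> h; apply/negbTE; rewrite notin_setE].
  rewrite (_ : E t = pref @^-1` [set t.1.1] `&`
      ([set s | (snoc s false \in B) = t.1.2] `&`
       [set s | (snoc s true \in B) = t.2])); last first.
    by apply/seteqP; split => [s []|s [? []]].
  by apply: measurableI; [exact: measurable_pref|exact: measurableI].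
rewrite (_ : _ @^-1` Y = \bigcup_(t in [set t | Y (val t)]) E t).
  rewrite bigcup_mkcond; apply: countable_bigcupT_measurable; first exact: countableP.
  by move=> t; case: ifP.
apply/seteqP; split => s /=.
  pose t := (pref s, snoc s false \in B, snoc s true \in B).
  have Et : E t s by [].
  by move=> Ys; exists t => //=; rewrite -(vE _ _ Et).
by move=> [t /= Yt /vE ->].
Qed.

HB.instance Definition _ := isKernel.Build _ _ _ _ _ vlmc measurable_vlmc.

Let vlmc_setT s : vlmc s setT = 1%E.
Proof. exact: probability_setT. Qed.

HB.instance Definition _ := Kernel_isProbability.Build _ _ _ _ _ vlmc vlmc_setT.

End vlmc.

Section stationary_measures.
Context {R : realType} (q : context -> probability bool R).
Implicit Types (pi mu : probability leftseq R) (w u : word).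

Definition stationary pi : Prop := forall B : set leftseq, measurable B ->
  (\int[pi]_s vlmc q s B)%E = pi B.

(* Elements of [probability leftseq R] are functions on all subsets; as
   measures they only have to agree on the sigma-algebra. *)
Definition same_measure pi mu : Prop :=
  forall B : set leftseq, measurable B -> pi B = mu B.

Definition unique_measure (P : probability leftseq R -> Prop) pi : Prop :=
  P pi /\ forall mu, P mu -> same_measure mu pi.

Definition trivial_measure pi : Prop := exists s : leftseq,
  forall B : set leftseq, measurable B -> pi B = \d_s B.

Definition letter (c : context) (a : bool) : R := fine (q c [set a]).

Definition mass pi w : R := fine (pi (cylinder w)).

Definition comb_coef (n : nat) : R := \prod_(0 <= k < n) letter (Some k) false.

(* Meant for u in [comb]: internal nodes are the words 0^n, and a leaf 0^n 1
   has its only letter 1 at index n. *)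
Definition ext_letter pi u (a : bool) : R :=
  if u == nseq (size u) false then
    if mass pi (rev u) == 0 then 0
    else mass pi (rcons (rev u) a) / mass pi (rev u)
  else letter (Some (index true u)) a.

Definition formula1 pi : Prop := forall n,
  mass pi (true :: nseq n false) = mass pi [:: true] * comb_coef n.

Definition formula2 pi : Prop := forall n,
  mass pi (nseq n false) = 1 - mass pi [:: true] * \sum_(0 <= k < n) comb_coef k.

Definition formula3 pi : Prop := forall w,
  mass pi w = \prod_(0 <= k < size w)
    ext_letter pi (pref_word (take k w)) (nth false w k).

End stationary_measures.

(* Main.v *)
Require Import Defs.
From HB Require Import structures.
From mathcomp Require Import all_boot all_order all_algebra.
From mathcomp Require Import all_classical all_reals all_analysis.
From mathcomp Require Import measurable_realfun.
From mathcomp Require Import lra.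
Import Order.TTheory GRing.Theory Num.Theory.
Import numFieldNormedType.Exports.
Local Open Scope classical_set_scope.
Local Open Scope ring_scope.

(** The proof reduces stationarity, on one side, and the formulae, on the other,
    to one recursion on the masses of words, and then solves that recursion.

    If a word w contains a letter 1, all sequences ending in w have the same
    context 0^n 1, where n is the number of 0s at the end of w; so a stationary
    measure satisfies pi(w a) = pi(w) q_(0^n 1)(a) for such w ([renewal]).  This
    says nothing about words 0^n, but additivity on the left,
    pi(w) = pi(0 w) + pi(1 w), fills the gap: with p = pi(1) one gets in turn
    pi(1 0^n) = p c_n, then pi(0^n) = 1 - p (c_0 + ... + c_(n-1)), then
    pi(0^n 1) = p c_n, so that p determines the whole measure
    ([renewal_unique], [eq_rmass]).  Conversely the function given by these
    values ([comb_mass]) is additive on the left, and for p >= 0 it is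
    nonnegative as soon as p (c_0 + ... + c_(n-1)) <= 1 for all n; it is then the
    mass function of a probability measure ([exists_renewal_measure]), built by
    coding the points of [0, 1[ with Lebesgue measure
    ([exists_measure_of_rmass]).

    The recursion is equivalent to [formula3], and implies [formula1] and
    [formula2] ([formula3_renewal], [renewal_formulas]).  Stationarity is a little stronger:
    the sequence 0^oo is seen by no word containing a 1, and it contributes the
    extra equation pi(0^oo) = pi(0^oo) q_(0^oo)(0) ([stationary_renewal]).

    Letting n tend to infinity, pi(0^oo) = 1 - p S(1) when the series converges,
    whereas its divergence forces p = 0, that is pi(0^oo) = 1.  If
    q_(0^oo)(0) <> 1, the extra equation says pi(0^oo) = 0, hence p = 1 / S(1)
    and divergence is excluded; if q_(0^oo)(0) = 1 the extra equation is void and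
    a = pi(0^oo) is a free parameter, with p = (1 - a) / S(1)
    ([stationary_family] treats both cases).  Finally a Dirac measure has p = 0
    or p = 1, and 1 - a = p S(1) with S(1) >= 1 + q_1(0) leaves only the two
    announced cases. *)

(** * Masses of reversed words *)

Lemma reads_rcons u b s : reads (rcons u b) s <-> reads u s /\ s (size u) = b.
Proof.
by rewrite /reads size_rcons mkseqS; split=> [/rcons_inj[]|[-> ->]].
Qed.

Lemma reads_snoc a u b s : reads (a :: u) (snoc s b) <-> b = a /\ reads u s.
Proof.
have := cylinder_snoc (rev u) a s b.
by rewrite /cylinder /= rev_rcons revK.
Qed.

Lemma measurable_reads u : measurable ([set s | reads u s] : set leftseq).
Proof. by rewrite -[u]revK; exact: measurable_cylinder. Qed.

Lemma reads_take u v s : (size u <= size v)%N -> reads v s ->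
  reads u s <-> take (size u) v = u.
Proof.
move=> uv; rewrite /reads => vs.
suff -> : take (size u) v = mkseq s (size u) by [].
rewrite -[in LHS]vs.
by rewrite /mkseq -map_take take_iota (minn_idPl _).
Qed.

(** Two cylinders are nested or disjoint, hence the need to add the empty set
    to make a pi-system. *)
Lemma cylinder_setI_closed : setI_closed (range cylinder `|` [set set0]).
Proof.
have comparable u v : (size u <= size v)%N ->
    (range cylinder `|` [set set0])
      ([set s : leftseq | reads u s] `&` [set s | reads v s]).
  move=> uv; have [e|ne] := eqVneq (take (size u) v) u.
    left; exists (rev v) => //; rewrite /cylinder revK.
    apply/seteqP; split=> s /=; last by case.
    by move=> vs; split => //; apply/(reads_take _ _ _ uv vs).
  right; apply/seteqP; split=> s //= [us vs].
  by move/eqP: ne; apply; apply/(reads_take _ _ _ uv vs).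
move=> A B [[v _ <-]|->]; last by right; rewrite set0I.
case=> [[w _ <-]|->]; last by right; rewrite setI0.
have [/comparable //|/ltnW/comparable] := leqP (size (rev v)) (size (rev w)).
by rewrite setIC.
Qed.

Section prefix_masses.
Context {R : realType}.
Implicit Types mu nu : probability leftseq R.

(** Indexing masses by the reversed word makes [mass mu w] convertible to
    [rmass mu (rev w)] and turns the leftmost letters, which the contexts
    look at last, into the end of a list. *)
Definition rmass mu (u : word) : R := fine (mu [set s | reads u s]).

Lemma rmassE mu u : mu [set s | reads u s] = (rmass mu u)%:E.
Proof.
by rewrite /rmass fineK// fin_num_measure//; exact: measurable_reads.
Qed.

Lemma rmass_ge0 mu u : 0 <= rmass mu u.
Proof. by rewrite /rmass fine_ge0. Qed.

Lemma rmass_nil mu : rmass mu [::] = 1.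
Proof.
rewrite /rmass (_ : [set s | _] = setT) ?probability_setT//.
by apply/seteqP; split.
Qed.

Lemma rmass_rcons mu u :
  rmass mu u = rmass mu (rcons u false) + rmass mu (rcons u true).
Proof.
apply: EFin_inj; rewrite EFinD -!rmassE.
rewrite -(measureU mu); try exact: measurable_reads.
  congr (mu _); apply/seteqP; split => s /=.
    move=> us; case E : (s (size u)); [right|left]; exact/reads_rcons.
  by case=> /reads_rcons[].
by apply/seteqP; split => s //= -[/reads_rcons[_ sf] /reads_rcons[_]]; rewrite sf.
Qed.

Lemma eq_rmass mu nu : rmass mu =1 rmass nu -> same_measure mu nu.
Proof.
move=> h B mB.
have gen : (measurable : set (set leftseq)) = <<s range cylinder `|` [set set0] >>.
  apply/seteqP; split.
    by apply: sub_sigma_algebra2 => A; left.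
  apply: smallest_sub => //; first exact: sigma_algebra_measurable.
  by move=> A [[w _ <-]|->]; [exact: measurable_cylinder|exact: measurable0].
apply: (measure_unique _ (fun=> setT) gen cylinder_setI_closed) => //.
- by move=> _; left; exists [::] => //; apply/seteqP; split.
- by apply/seteqP; split => // s _; exists 0%N.
- move=> A [[w _ <-]|->]; last by rewrite !measure0.
  exact: (etrans (rmassE mu _) (etrans (congr1 EFin (h _)) (esym (rmassE nu _)))).
- by move=> _; apply: le_lt_trans (probability_le1 mu measurableT) (ltry 1).
Qed.

End prefix_masses.

(** * A probability measure with prescribed masses *)

Definition unit_lebesgue {R : realType} : set (measurableTypeR R) -> \bar R :=
  mrestr lebesgue_measure (measurable_itv `[(0:R), 1[).

Section unit_lebesgue_probability.
Context {R : realType}.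

HB.instance Definition _ := Measure.on (@unit_lebesgue R).

Let unit_lebesgue_setT : @unit_lebesgue R setT = 1%E.
Proof.
rewrite /unit_lebesgue /mrestr setTI lebesgue_measure_itv/= lte_fin ltr01.
by rewrite oppr0 adde0.
Qed.

HB.instance Definition _ :=
  Measure_isProbability.Build _ _ R (@unit_lebesgue R) unit_lebesgue_setT.

End unit_lebesgue_probability.

(** The interval [0, 1[ is cut into one interval of length [M u] for each word u
    of a given length, the interval of u being cut at [split_point u] into those
    of u0 and u1.  Sending x to the sequence of its choices pushes Lebesgue
    measure to the desired measure. *)
Section digit_coding.
Context {R : realType} (M : word -> R).
Hypothesis M_ge0 : forall u, 0 <= M u.
Hypothesis M_nil : M [::] = 1.
Hypothesis M_rcons : forall u, M u = M (rcons u false) + M (rcons u true).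

(* The left end of the interval of u. *)
Let lower (u : word) : R :=
  \sum_(0 <= i < size u) (if nth false u i then M (rcons (take i u) false) else 0).

Let lower_rcons u b :
  lower (rcons u b) = lower u + (if b then M (rcons u false) else 0).
Proof.
rewrite /lower size_rcons big_nat_recr//= nth_rcons ltnn eqxx.
rewrite -(cats1 u b) take_size_cat//; congr (_ + _).
apply: eq_big_nat => i /andP[_ iu].
by rewrite nth_cat iu takel_cat// ltnW.
Qed.

Let split_point u := lower u + M (rcons u false).

Let path (x : R) : nat -> word :=
  fix path n := if n is m.+1 then
    rcons (path m) (split_point (path m) <= x) else [::].

Let digits (x : R) : leftseq := fun n => split_point (path x n) <= x.

Let mkseq_digits x n : mkseq (digits x) n = path x n.
Proof. by elim: n => //= n IH; rewrite mkseqS IH. Qed.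

Let reads_digits u b x : reads (rcons u b) (digits x) <->
  reads u (digits x) /\ (split_point u <= x) = b.
Proof.
split=> [/reads_rcons[us <-]|[us e]].
  by split => //; rewrite /digits -mkseq_digits us.
by apply/reads_rcons; split => //; rewrite /digits -mkseq_digits us.
Qed.

Let measurable_reads_digits u :
  measurable [set x : measurableTypeR R | reads u (digits x)].
Proof.
elim/last_ind: u => [|u b IH].
  by rewrite (_ : [set x | _] = setT)//; apply/seteqP; split.
rewrite (_ : [set x | _] = [set x | reads u (digits x)] `&`
    [set` if b then `[split_point u, +oo[ else `]-oo, split_point u[]).
  by apply: measurableI => //; case: b.
apply/seteqP; split => x /=.
  move=> /reads_digits[? e]; split => //; case: b e => e /=;
    rewrite in_itv/= ?e// ltNge e//.
move=> [ux xb]; apply/reads_digits; split=> //; case: b xb;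
  rewrite /= in_itv/= ?andbT// => h.
by apply/negbTE; rewrite -ltNge.
Qed.

Let measurable_digits : measurable_fun [set: measurableTypeR R] digits.
Proof.
apply: (@measurability _ _ _ leftseq _ _ (range cylinder)) => //.
by move=> _ [_ [w _ <-] <-]; rewrite setTI; exact: measurable_reads_digits.
Qed.

Let digits_itv u x :
  0 <= x < 1 /\ reads u (digits x) <-> lower u <= x < lower u + M u.
Proof.
elim/last_ind: u => [|u b IH].
  by rewrite /lower big_geq// add0r M_nil; split=> [[]|].
rewrite reads_digits lower_rcons.
have := M_ge0 (rcons u false); have := M_ge0 (rcons u true).
have := M_rcons u; rewrite /split_point => e t0 f0.
split.
  move=> [x01 [ux <-]]; have := (proj1 IH (conj x01 ux)) => /andP[lx xl].
  by case: (leP (lower u + M (rcons u false)) x) => h /=; apply/andP; split; lra.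
case: b => /= /andP[lx xl].
  have /(proj2 IH)[x01 ux] : lower u <= x < lower u + M u by apply/andP; split; lra.
  by split=> //; split=> //; apply/idP; lra.
have /(proj2 IH)[x01 ux] : lower u <= x < lower u + M u by apply/andP; split; lra.
by split=> //; split=> //; apply/negbTE; rewrite -ltNge; lra.
Qed.

Lemma exists_measure_of_rmass : exists mu : probability leftseq R, rmass mu =1 M.
Proof.
pose f : {mfun measurableTypeR R >-> leftseq} :=
  HB.pack digits (@isMeasurableFun.Build _ _ (measurableTypeR R) leftseq digits
    measurable_digits).
exists (distribution (@unit_lebesgue R) f : probability leftseq R) => u.
suff e : lebesgue_measure ([set x : measurableTypeR R | reads u (digits x)]
    `&` `[0, 1[) = (M u)%:E by exact: (congr1 fine e).
rewrite (_ : _ `&` _ = `[lower u, lower u + M u[%classic).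
  rewrite lebesgue_measure_itv/= lte_fin ltrDl; case: ifPn => [_|].
    by rewrite -EFinD addrAC subrr add0r.
  by rewrite -leNgt => M0; congr EFin; apply: le_anti; rewrite M0 M_ge0.
apply/seteqP; split => x /=; rewrite !in_itv/=.
  by move=> [ux x01]; apply/digits_itv.
by move=> /digits_itv[].
Qed.

End digit_coding.

(** * The recursion on masses and its solution *)

Lemma index_leaf n : index true (leaf n) = n.
Proof. by rewrite /leaf -cats1 index_cat mem_nseq andbF size_nseq /= addn0. Qed.

Lemma mem_leaf n : true \in leaf n.
Proof. by rewrite /leaf mem_rcons mem_head. Qed.

Lemma rcons_nseq_false n : rcons (nseq n false) false = nseq n.+1 false.
Proof. by elim: n => //= n ->. Qed.

Lemma notin_true (u : word) : true \notin u -> u = nseq (size u) false.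
Proof.
move=> tu; apply/all_pred1P/allP => -[] //= ut.
by rewrite ut in tu.
Qed.

Section letters.
Context {R : realType} (q : context -> probability bool R).

Lemma letterE c a : q c [set a] = (letter q c a)%:E.
Proof. by rewrite /letter fineK// fin_num_measure. Qed.

Lemma letter_ge0 c a : 0 <= letter q c a.
Proof. by rewrite /letter fine_ge0. Qed.

Lemma letter_sum c : letter q c false + letter q c true = 1.
Proof.
apply: EFin_inj; rewrite EFinD -!letterE -(measureU (q c))//.
  rewrite -(probability_setT (q c)); congr (q c _).
  by apply/seteqP; split => -[] //= _; [right|left].
by apply/seteqP; split => // -[] [].
Qed.

Lemma comb_coef0 : comb_coef q 0 = 1.
Proof. by rewrite /comb_coef big_geq. Qed.

Lemma comb_coefS n : comb_coef q n.+1 = comb_coef q n * letter q (Some n) false.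
Proof. by rewrite /comb_coef big_nat_recr. Qed.

Lemma comb_coef_ge0 n : 0 <= comb_coef q n.
Proof. by apply: prodr_ge0 => k _; exact: letter_ge0. Qed.

End letters.

Section renewal.
Context {R : realType} (q : context -> probability bool R).

(** On reversed words, [a :: u] is the word followed by the letter a, and
    [index true u] counts the letters 0 after its last 1.  The word has to contain
    a 1, since otherwise it does not determine the context. *)
Definition renewal (F : word -> R) := forall u a, true \in u ->
  F (a :: u) = F u * letter q (Some (index true u)) a.

Section masses.
Variable F : word -> R.
Hypothesis F_nil : F [::] = 1.
Hypothesis F_rcons : forall u, F u = F (rcons u false) + F (rcons u true).
Hypothesis F_renewal : renewal F.

Lemma renewal_leaf n : F (leaf n) = F [:: true] * comb_coef q n.
Proof.
elim: n => [|n IH]; first by rewrite comb_coef0 mulr1.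
rewrite -[leaf n.+1]/(false :: leaf n) F_renewal ?mem_leaf// IH index_leaf.
by rewrite comb_coefS mulrA.
Qed.

Lemma renewal_zeros n :
  F (nseq n false) = 1 - F [:: true] * series (comb_coef q) n.
Proof.
rewrite /series /=; elim: n => [|n IH]; first by rewrite big_geq// mulr0 subr0.
have := F_rcons (nseq n false).
rewrite rcons_nseq_false -/(leaf n) renewal_leaf IH big_nat_recr//=.
by lra.
Qed.

(** By left additivity at 0^n 1, the masses of 0^n 1 and 0^(n+1) 1 differ by
    that of 1 0^n 1, which is p c_n (1 - q_(0^n 1)(0)) = p (c_n - c_(n+1)). *)
Lemma renewal_one_zeros n : F (true :: nseq n false) = F [:: true] * comb_coef q n.
Proof.
elim: n => [|n IH]; first by rewrite comb_coef0 mulr1.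
have := F_rcons (true :: nseq n false).
rewrite /= rcons_nseq_false -/(leaf n) IH.
rewrite (F_renewal (leaf n)) ?mem_leaf// renewal_leaf.
have := letter_sum q (Some n).
rewrite index_leaf comb_coefS.
set x := letter _ _ _; set y := letter _ _ _; set c := comb_coef _ _.
move=> xy; rewrite (_ : y = 1 - x); last by lra.
by lra.
Qed.

End masses.

(** The recursion reduces any word to one of the form 0^n or 0^n 1, and the masses
    of these depend on the mass of the word 1 alone. *)
Lemma renewal_unique F G :
  F [::] = 1 -> (forall u, F u = F (rcons u false) + F (rcons u true)) ->
  G [::] = 1 -> (forall u, G u = G (rcons u false) + G (rcons u true)) ->
  renewal F -> renewal G -> F [:: true] = G [:: true] -> F =1 G.
Proof.
move=> F0 Fr G0 Gr Fn Gn FG; elim=> [|a u IH]; first by rewrite F0 G0.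
have [tu|/notin_true ->] := boolP (true \in u); first by rewrite Fn// Gn// IH.
case: a; first by rewrite !renewal_one_zeros// FG.
by rewrite -[_ :: _]/(nseq (size u).+1 false) !renewal_zeros// FG.
Qed.

(** The values are those forced by [renewal_zeros], [renewal_one_zeros] and the
    recursion. *)
Fixpoint comb_mass (p : R) (u : word) : R :=
  if u is a :: v then
    if true \in v then comb_mass p v * letter q (Some (index true v)) a
    else if a then p * comb_coef q (size v)
    else 1 - p * series (comb_coef q) (size v).+1
  else 1.

Lemma comb_mass_renewal p : renewal (comb_mass p).
Proof. by move=> u a /= ->. Qed.

Lemma comb_mass_leaf p n : comb_mass p (leaf n) = p * comb_coef q n.
Proof.
elim: n => [//|n IH].
rewrite -[leaf n.+1]/(false :: leaf n) /= mem_leaf IH index_leaf.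
by rewrite comb_coefS mulrA.
Qed.

Lemma comb_mass_zeros p n :
  comb_mass p (nseq n false) = 1 - p * series (comb_coef q) n.
Proof.
case: n => [|n] /=; first by rewrite /series /= big_geq// mulr0 subr0.
by rewrite mem_nseq andbF size_nseq.
Qed.

Lemma comb_mass_one_zeros p n :
  comb_mass p (true :: nseq n false) = p * comb_coef q n.
Proof. by rewrite /= mem_nseq andbF size_nseq. Qed.

(** On words with a 1 before the last letter additivity is inherited through the
    recursion, so it only has to be checked on 0^n, where it holds by the choice of the partial
    sums, and on 0^n 1, where it is the identity
    c_n = c_(n+1) + c_n q_(0^n 1)(1). *)
Lemma comb_mass_rcons p u :
  comb_mass p u = comb_mass p (rcons u false) + comb_mass p (rcons u true).
Proof.
elim: u => [|a u IH].
  by rewrite /= /series /= big_nat1 comb_coef0; lra.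
have [tu|/notin_true ->] := boolP (true \in u).
  have indexr b : index true (rcons u b) = index true u.
    by rewrite -cats1 index_cat tu.
  by rewrite /= !mem_rcons !inE tu !orbT !indexr IH mulrDl.
set n := size u; rewrite !rcons_cons rcons_nseq_false -/(leaf n).
rewrite (comb_mass_renewal _ (leaf n)) ?mem_leaf// index_leaf comb_mass_leaf.
have := letter_sum q (Some n).
case: a => [|_].
  rewrite !comb_mass_one_zeros comb_coefS.
  set x := letter _ _ _; set y := letter _ _ _; set c := comb_coef _ _.
  move=> xy; rewrite (_ : y = 1 - x); last by lra.
  by lra.
rewrite -[false :: nseq n false]/(nseq n.+1 false).
rewrite -[false :: nseq n.+1 false]/(nseq n.+2 false) !comb_mass_zeros.
rewrite -mulrA -comb_coefS /series /= [in RHS]big_nat_recr//=.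
by lra.
Qed.

Lemma comb_mass_ge0 p u : 0 <= p ->
  (forall n, p * series (comb_coef q) n <= 1) -> 0 <= comb_mass p u.
Proof.
move=> p0 pS; elim: u => [|a u IH] //=; case: ifP => _.
  by rewrite mulr_ge0// letter_ge0.
by case: a; [rewrite mulr_ge0// comb_coef_ge0|rewrite subr_ge0].
Qed.

Lemma exists_renewal_measure p : 0 <= p ->
  (forall n, p * series (comb_coef q) n <= 1) ->
  exists mu : probability leftseq R, renewal (rmass mu) /\ rmass mu [:: true] = p.
Proof.
move=> p0 pS; have [mu muE] := exists_measure_of_rmass _
  (fun u => comb_mass_ge0 p u p0 pS) erefl (comb_mass_rcons p).
exists mu; split; last by rewrite muE /= comb_coef0 mulr1.
by move=> u a tu; rewrite !muE comb_mass_renewal.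
Qed.

End renewal.

(** * The recursion and the product formulae *)

Section formulas.
Context {R : realType} (q : context -> probability bool R).
Implicit Types mu : probability leftseq R.

Lemma leaf_neq_zeros n k : leaf n <> nseq k false.
Proof. by move=> e; have := mem_leaf n; rewrite e mem_nseq andbF. Qed.

Lemma suffix_leaf_index n (w : word) :
  suffix (rev (leaf n)) w -> index true (rev w) = n.
Proof.
rewrite -{1}[w]revK suffix_rev => /prefixP[v ->].
by rewrite index_cat mem_leaf index_leaf.
Qed.

Lemma pref_word_true (w : word) :
  true \in w -> pref_word w = leaf (index true (rev w)).
Proof.
move=> tw; have := pref_wordP w; case: ifP => [|_ [n [-> /suffix_leaf_index ->]]//].
rewrite inE => -[[n _ e]|[n _ e] ->]; last by rewrite -e index_leaf.
by move: tw; rewrite -mem_rev -e mem_nseq andbF.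
Qed.

Lemma pref_word_zeros n : pref_word (nseq n false) = nseq n false.
Proof.
have := pref_wordP (nseq n false); rewrite rev_nseq ifT//.
by rewrite inE; left; exists n.
Qed.

Lemma ext_letter_leaf mu n a : ext_letter q mu (leaf n) a = letter q (Some n) a.
Proof. by rewrite /ext_letter index_leaf; case: eqP => // /leaf_neq_zeros. Qed.

Lemma ext_letter_zeros mu n a : ext_letter q mu (nseq n false) a =
  if rmass mu (nseq n false) == 0 then 0
  else rmass mu (a :: nseq n false) / rmass mu (nseq n false).
Proof.
by rewrite /ext_letter size_nseq eqxx /mass /cylinder rev_rcons revK.
Qed.

Lemma formula3_rcons mu : formula3 q mu <-> forall w a,
  mass mu (rcons w a) = mass mu w * ext_letter q mu (pref_word w) a.
Proof.
split=> [h w a|h].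
  rewrite !h size_rcons big_nat_recr//= nth_rcons ltnn eqxx.
  rewrite -(cats1 w a) take_size_cat//; congr (_ * _).
  apply: eq_big_nat => k /andP[_ kw].
  by rewrite nth_cat kw takel_cat// ltnW.
elim/last_ind => [|w a IH].
  by rewrite big_geq//; exact: rmass_nil.
rewrite h IH size_rcons big_nat_recr//= nth_rcons ltnn eqxx.
rewrite -(cats1 w a) take_size_cat//; congr (_ * _).
apply: eq_big_nat => k /andP[_ kw].
by rewrite nth_cat kw takel_cat// ltnW.
Qed.

(** On words containing a 1 the extended letter probabilities are those of a
    leaf, independent of the measure. *)
Lemma formula3_renewal mu : formula3 q mu -> renewal q (rmass mu).
Proof.
move=> /formula3_rcons h u a tu; have := h (rev u) a.
by rewrite /mass /cylinder rev_rcons revK pref_word_true ?mem_rev// revK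
  ext_letter_leaf.
Qed.

Lemma renewal_formulas mu : renewal q (rmass mu) ->
  [/\ formula1 q mu, formula2 q mu & formula3 q mu].
Proof.
move=> mun.
have leafE := renewal_leaf _ _ mun.
have zerosE := renewal_zeros _ _ (rmass_nil mu) (rmass_rcons mu) mun.
have onezeroE := renewal_one_zeros _ _ (rmass_rcons mu) mun.
split.
- by move=> n; rewrite -leafE /leaf -[X in rmass mu X]revK rev_rcons rev_nseq.
- by move=> n; rewrite -zerosE -[X in rmass mu X]revK rev_nseq.
apply/formula3_rcons => w a.
rewrite /mass /cylinder rev_rcons -/(rmass mu _) -/(rmass mu (rev w)).
have [tw|/notin_true ->] := boolP (true \in w).
  by rewrite mun ?mem_rev// pref_word_true// ext_letter_leaf.
rewrite rev_nseq pref_word_zeros ext_letter_zeros; set n := size w.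
have [m0|m0] := eqVneq; last by rewrite mulrCA divff// mulr1.
(* A null 0^n makes 0^n 0 and 0^n 1 null too: their masses T_(n+1) and p c_n
   are nonnegative, with sum the mass of 0^n. *)
rewrite mulr0; have := rmass_rcons mu (nseq n false).
rewrite m0 rcons_nseq_false -/(leaf n) leafE -onezeroE.
have := rmass_ge0 mu (nseq n.+1 false); have := rmass_ge0 mu (true :: nseq n false).
by case: a => /=; lra.
Qed.

End formulas.

(** * Stationarity *)

Lemma constseq_bigcap b :
  [set constseq b] = \bigcap_n [set s : leftseq | reads (nseq n b) s].
Proof.
apply/seteqP; split=> s /=.
  move=> -> n _; rewrite /= /reads size_nseq.
  by apply: (@eq_from_nth _ b); rewrite ?size_mkseq ?size_nseq// => i ni;
    rewrite nth_mkseq// nth_nseq ni.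
move=> h; apply/funext => n; have := h n.+1 I.
rewrite /= -[b :: nseq n b]/(nseq n.+1 b) /reads size_nseq.
move=> /(congr1 (nth b ^~ n)).
by rewrite nth_mkseq// nth_nseq if_same.
Qed.

Lemma measurable_constseq b : measurable [set constseq b].
Proof.
rewrite constseq_bigcap; apply: bigcap_measurable => // n _.
exact: measurable_reads.
Qed.

Lemma pref_reads u s : true \in u -> reads u s -> pref s = Some (index true u).
Proof.
move=> tu us; apply: pref_eq; apply/reads_leaf; rewrite -us.
have iu : (index true u < size u)%N by rewrite index_mem.
split.
  by rewrite us -[in LHS](nth_mkseq false s iu) us nth_index.
move=> k ku; rewrite us in ku.
have ksu := ltn_trans ku iu.
rewrite -[in LHS](nth_mkseq false s ksu) us.
by apply/negbTE; have := before_find false ku; rewrite /= eqb_id => ->.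
Qed.

Section one_step.
Context {R : realType} (q : context -> probability bool R).
Implicit Types mu : probability leftseq R.

Lemma rmass_cvg mu b :
  rmass mu (nseq n b) @[n --> \oo] --> fine (mu [set constseq b]).
Proof.
rewrite constseq_bigcap; apply: fine_cvg.
rewrite fineK; last first.
  rewrite fin_num_measure// -constseq_bigcap; exact: measurable_constseq.
apply: nonincreasing_cvg_mu.
- by apply: le_lt_trans (probability_le1 mu _) (ltry 1); exact: measurable_reads.
- by move=> n; exact: measurable_reads.
- by rewrite -constseq_bigcap; exact: measurable_constseq.
move=> m n mn; apply/subsetPset => s /= ns.
apply/(reads_take _ (nseq n b)); rewrite ?size_nseq//.
by rewrite take_nseq.
Qed.

(** The law of U_1 when U_0 has law [mu]. *)
Definition step mu (B : set leftseq) : \bar R := (\int[mu]_s vlmc q s B)%E.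

Section step_probability.
Variable mu : probability leftseq R.

Let step0 : step mu set0 = 0%E.
Proof. by rewrite /step; apply: integral0_eq => s _; rewrite measure0. Qed.

Let step_ge0 B : (0 <= step mu B)%E.
Proof. exact: integral_ge0. Qed.

Let step_sigma_additive : semi_sigma_additive (step mu).
Proof.
move=> U mU tU mUU; rewrite [X in _ --> X](_ : _ =
  (\int[mu]_s (\sum_(n <oo) vlmc q s (U n)))%E); last first.
  apply: eq_integral => s _.
  by apply/esym/cvg_lim => //; exact/measure_semi_sigma_additive.
apply/cvg_closeP; split.
  by apply: is_cvg_nneseries => n _ _; exact: integral_ge0.
rewrite closeE// integral_nneseries// => n.
exact: measurable_kernel.
Qed.

HB.instance Definition _ := isMeasure.Build _ _ R (step mu)
  step0 step_ge0 step_sigma_additive.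

Let step_setT : step mu setT = 1%E.
Proof.
rewrite /step (eq_integral (cst 1%E)).
  by rewrite integral_cst// mul1e; exact: probability_setT.
by move=> s _; exact: prob_kernel.
Qed.

HB.instance Definition _ := Measure_isProbability.Build _ _ R (step mu) step_setT.

End step_probability.

Lemma vlmc_reads s a u : vlmc q s [set t | reads (a :: u) t] =
  (q (pref s) [set a] * (\1_[set t : leftseq | reads u t] s)%:E)%E.
Proof.
rewrite /vlmc /distribution /pushforward indicE.
have [us|us] := boolP (s \in _); rewrite (inE, notin_setE) in us.
  rewrite mule1; congr (q _ _); apply/seteqP; split => b /=.
    by move=> /reads_snoc[].
  by move=> ->; exact/reads_snoc.
rewrite mule0 -(measure0 (q (pref s))); congr (q _ _).
apply/seteqP; split => // b /=.
by move=> /reads_snoc[].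
Qed.

Lemma vlmc_constseq s : vlmc q s [set constseq false] =
  (q None [set false] * (\1_[set constseq false] s)%:E)%E.
Proof.
rewrite /vlmc /distribution /pushforward indicE.
have snoc_const (t : leftseq) b :
    snoc t b = constseq false <-> b = false /\ t = constseq false.
  split=> [h|[-> ->]]; last by apply/funext => -[].
  split; first exact: (congr1 (@^~ 0%N) h).
  by apply/funext => n; exact: (congr1 (@^~ n.+1) h).
have [|us] := boolP (s \in _).
  rewrite inE => -> /=; rewrite mule1 (_ : pref _ = None); last exact: pref_eq.
  by congr (q _ _); apply/seteqP; split => b /=; [move=> /snoc_const[]|
    move=> ->; apply/snoc_const].
rewrite notin_setE in us.
rewrite mule0 -(measure0 (q (pref s))); congr (q _ _).
apply/seteqP; split => // b /=.
by move=> /snoc_const[].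
Qed.

Lemma integral_scaled_indic mu (k : R) (A : set leftseq) : measurable A ->
  (\int[mu]_s (k%:E * (\1_A s)%:E))%E = (k%:E * mu A)%E.
Proof.
move=> mA; rewrite integralZl//; last exact: integrable_indic.
by rewrite integral_indic// setIT.
Qed.

Lemma rmass_step mu u a : true \in u ->
  rmass (step mu) (a :: u) = rmass mu u * letter q (Some (index true u)) a.
Proof.
move=> tu; suff e : step mu [set s | reads (a :: u) s] =
    (rmass mu u * letter q (Some (index true u)) a)%:E by exact: (congr1 fine e).
rewrite /step (eq_integral (fun s => (letter q (Some (index true u)) a)%:E *
    (\1_[set t : leftseq | reads u t] s)%:E)%E); last first.
  move=> s _; rewrite vlmc_reads indicE.
  have [us|_] := boolP (s \in _); last by rewrite !mule0.
  by rewrite inE in us; rewrite (pref_reads _ _ tu us) letterE.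
rewrite integral_scaled_indic; last exact: measurable_reads.
by rewrite rmassE -EFinM mulrC.
Qed.

(** The chain enters 0^oo only from 0^oo, by adding a letter 0. *)
Lemma step_constseq mu : fine (step mu [set constseq false]) =
  fine (mu [set constseq false]) * letter q None false.
Proof.
rewrite /step (eq_integral (fun s => (letter q None false)%:E *
    (\1_[set constseq false] s)%:E)%E); last first.
  by move=> s _; rewrite vlmc_constseq letterE.
rewrite integral_scaled_indic; last exact: measurable_constseq.
rewrite fineM// 1?mulrC// fin_num_measure//; exact: measurable_constseq.
Qed.

(** For the converse, the law of U_1 is compared with that of U_0 on words.  They
    agree on words with a 1 before the last letter, by the recursion.  For words
    0^k a, left additivity makes the difference between the two masses
    independent of k; it vanishes for a = 0 because in the limit both masses
    become those of 0^oo, which agree by the equation at 0^oo, and then for a = 1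
    because the total mass is 1. *)
Lemma stationary_renewal mu : stationary q mu <->
  renewal q (rmass mu) /\
  fine (mu [set constseq false]) =
    fine (mu [set constseq false]) * letter q None false.
Proof.
split=> [st|[mun muz]].
  split=> [u a tu|].
    rewrite -rmass_step//; exact: esym (congr1 fine (st _ (measurable_reads _))).
  rewrite -step_constseq; exact: esym (congr1 fine (st _ (measurable_constseq _))).
suff h : rmass (step mu) =1 rmass mu by move=> B mB; exact: eq_rmass h B mB.
have extend a k :
    rmass (step mu) (a :: nseq k.+1 false) - rmass mu (a :: nseq k.+1 false) =
    rmass (step mu) (a :: nseq k false) - rmass mu (a :: nseq k false).
  have := rmass_rcons (step mu) (a :: nseq k false).
  have := rmass_rcons mu (a :: nseq k false).
  rewrite !rcons_cons rcons_nseq_false -/(leaf k) => -> ->.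
  by rewrite (rmass_step mu (leaf k)) ?mem_leaf// (mun (leaf k)) ?mem_leaf//; lra.
have extend0 a k :
    rmass (step mu) (a :: nseq k false) - rmass mu (a :: nseq k false) =
    rmass (step mu) [:: a] - rmass mu [:: a].
  by elim: k => [//|k <-]; exact: extend.
have e0 : rmass (step mu) [:: false] - rmass mu [:: false] = 0.
  have : rmass (step mu) (nseq n.+1 false) - rmass mu (nseq n.+1 false)
      @[n --> \oo]
      --> fine (step mu [set constseq false]) - fine (mu [set constseq false]).
    apply: cvgB.
      rewrite (cvg_shiftS (fun n => rmass (step mu) (nseq n false))).
      exact: rmass_cvg.
    rewrite (cvg_shiftS (fun n => rmass mu (nseq n false))).
    exact: rmass_cvg.
  rewrite step_constseq -muz subrr => /cvg_lim <- //.
  apply/esym/cvg_lim => //;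
  rewrite (_ : (fun n => _) =
      cst (rmass (step mu) [:: false] - rmass mu [:: false])).
    exact: cvg_cst.
  by apply/funext => n; exact: (extend0 false n).
have e1 : rmass (step mu) [:: true] - rmass mu [:: true] = 0.
  have := rmass_rcons (step mu) [::]; have := rmass_rcons mu [::].
  by rewrite !rmass_nil /=; lra.
case=> [|a u]; first by rewrite !rmass_nil.
have [tu|/notin_true ->] := boolP (true \in u).
  by rewrite rmass_step// mun.
by apply/eqP; rewrite -subr_eq0 extend0; case: a; rewrite ?e0 ?e1.
Qed.

End one_step.

(** * The stationary measures *)

Lemma dirac_of_mass1 {R : realType} (mu : probability leftseq R) s :
  measurable [set s] -> mu [set s] = 1%E ->
  forall B, measurable B -> mu B = \d_s B.
Proof.
move=> ms mus B mB; rewrite diracE; have [sB|sB] := boolP (s \in B).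
  apply/eqP; rewrite eq_le probability_le1//= -mus.
  by apply: le_measure; rewrite ?inE// => t ->; rewrite inE in sB.
rewrite notin_setE in sB; apply: (subset_measure0 mB (measurableC ms)).
  by move=> t tB /= ts; rewrite ts in tB.
by apply: etrans (probability_setC mu ms) _; rewrite mus subee.
Qed.

Section stationary_law.
Context {R : realType} (q : context -> probability bool R).
Implicit Types mu : probability leftseq R.

Let S := limn (series (comb_coef q)).

Lemma unique_mass1 mu b : mu [set constseq b] = 1%E ->
  unique_measure (fun nu => nu [set constseq b] = 1%E) mu.
Proof.
move=> mub; split=> // nu nub B mB.
by rewrite (dirac_of_mass1 nu _ (measurable_constseq b) nub)//
  (dirac_of_mass1 mu _ (measurable_constseq b) mub).
Qed.

Lemma trivial_mass1 mu b : mu [set constseq b] = 1%E -> trivial_measure mu.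
Proof.
by move=> mub; exists (constseq b); exact: dirac_of_mass1 (measurable_constseq b) mub.
Qed.

Lemma trivial_rmass mu u : trivial_measure mu -> rmass mu u = 0 \/ rmass mu u = 1.
Proof.
move=> [s ms]; rewrite /rmass ms; last exact: measurable_reads.
by rewrite diracE; case: (_ \in _); [right|left].
Qed.

Lemma nondecreasing_coef_series : nondecreasing_seq (series (comb_coef q)).
Proof.
apply/nondecreasing_seqP => n; rewrite /series /= big_nat_recr//= lerDl.
exact: comb_coef_ge0.
Qed.

Lemma renewal_series_le1 mu n : renewal q (rmass mu) ->
  rmass mu [:: true] * series (comb_coef q) n <= 1.
Proof.
move=> mun; have := rmass_ge0 mu (nseq n false).
by rewrite (renewal_zeros _ _ (rmass_nil mu) (rmass_rcons mu) mun) subr_ge0.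
Qed.

(** Otherwise the partial sums would be bounded by 1 / p. *)
Lemma divergent_no_one mu : renewal q (rmass mu) ->
  ~ cvgn (series (comb_coef q)) -> rmass mu [:: true] = 0.
Proof.
move=> mun dv; apply/eqP; apply: contrapT => /negP p0; apply: dv.
have p_gt0 : 0 < rmass mu [:: true] by rewrite lt_neqAle eq_sym p0 rmass_ge0.
apply: nondecreasing_is_cvgn; first exact: nondecreasing_coef_series.
exists (rmass mu [:: true])^-1 => _ [n _ <-].
by rewrite -[leRHS]mul1r ler_pdivlMr// mulrC; exact: renewal_series_le1.
Qed.

Lemma mass_zeros_no_one mu : renewal q (rmass mu) ->
  rmass mu [:: true] = 0 -> fine (mu [set constseq false]) = 1.
Proof.
move=> mun p0; apply/esym.
rewrite -(cvg_lim _ (rmass_cvg mu false))//; apply/esym/cvg_lim => //.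
rewrite (_ : (fun n => _) = cst 1); first exact: cvg_cst.
apply/funext => n.
by rewrite (renewal_zeros _ _ (rmass_nil mu) (rmass_rcons mu) mun) p0 mul0r subr0.
Qed.

Section convergent.
Hypothesis cvS : cvgn (series (comb_coef q)).

Lemma series_le_limn n : series (comb_coef q) n <= S.
Proof. exact: nondecreasing_cvgn_le nondecreasing_coef_series cvS n. Qed.

(** The left-hand side is c_0 + c_1. *)
Lemma limn_series_ge : 1 + letter q (Some 0%N) false <= S.
Proof.
have := series_le_limn 2; rewrite /series /= big_nat_recr//= big_nat1.
by rewrite comb_coefS comb_coef0 mul1r.
Qed.

Lemma limn_series_gt0 : 0 < S.
Proof. by have := limn_series_ge; have := letter_ge0 q (Some 0%N) false; lra. Qed.

Lemma mass_zeros_convergent mu : renewal q (rmass mu) ->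
  fine (mu [set constseq false]) = 1 - rmass mu [:: true] * S.
Proof.
move=> mun; rewrite -(cvg_lim _ (rmass_cvg mu false))//; apply/cvg_lim => //.
rewrite (_ : (fun n => _) =
    fun n => 1 - rmass mu [:: true] * series (comb_coef q) n).
  by apply: cvgB; [exact: cvg_cst|apply: cvgMr => //; exact: cvS].
apply/funext => n.
by rewrite (renewal_zeros _ _ (rmass_nil mu) (rmass_rcons mu) mun).
Qed.

Lemma mass_ones mu : renewal q (rmass mu) -> rmass mu [:: true] = 1 ->
  letter q (Some 0%N) false = 0 -> mu [set constseq true] = 1%E.
Proof.
move=> mun p1 q0.
have q1 : letter q (Some 0%N) true = 1 by have := letter_sum q (Some 0%N); lra.
have e : fine (mu [set constseq true]) = 1.
  rewrite -(cvg_lim _ (rmass_cvg mu true))//; apply/cvg_lim => //.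
  rewrite (_ : (fun n => _) = cst 1); first exact: cvg_cst.
  apply/funext; elim=> [|[|n] IH] //=; first exact: rmass_nil.
  by rewrite mun ?mem_head//= q1 mulr1.
by rewrite -e fineK// fin_num_measure//; exact: measurable_constseq.
Qed.

Lemma limn_series1 : letter q (Some 0%N) false = 0 -> S = 1.
Proof.
move=> q0; apply: cvg_lim => //; rewrite -cvg_shiftS.
rewrite (_ : (fun n => series _ n.+1) = cst 1); first exact: cvg_cst.
apply/funext => n; rewrite /series /= big_nat_recl// comb_coef0.
rewrite big1 ?addr0// => i _.
by elim: i => [|i IH]; rewrite comb_coefS ?q0 ?mulr0// IH mul0r.
Qed.

(** The assumption on a is the stationarity equation at 0^oo.  It holds for
    a = 0 in the irreducible case and for every a in the reducible case, which
    is why both follow from this one statement. *)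
Lemma stationary_family a : 0 <= a <= 1 -> a * letter q None false = a ->
  exists pi : probability leftseq R,
    [/\ unique_measure (fun mu =>
          stationary q mu /\ mu [set constseq false] = a%:E) pi,
        unique_measure (fun mu => [/\
          mass mu [:: true] = (1 - a) / limn (series (comb_coef q)),
          formula1 q mu, formula2 q mu & formula3 q mu]) pi,
        trivial_measure pi <->
          (a = 1 \/ a = 0 /\ letter q (Some 0%N) false = 0),
        (a = 1 -> unique_measure (fun mu => mu [set constseq false] = 1%E) pi)
      & (a = 0 -> letter q (Some 0%N) false = 0 ->
          unique_measure (fun mu => mu [set constseq true] = 1%E) pi)].
Proof.
move=> a01 aq; have S0 := limn_series_gt0.
have p0 : 0 <= (1 - a) / S by rewrite divr_ge0; lra.
have pS n : (1 - a) / S * series (comb_coef q) n <= 1.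
  apply: le_trans (ler_wpM2l p0 (series_le_limn n)) _.
  by rewrite divfK ?gt_eqF//; lra.
have [pi [pin pip]] := exists_renewal_measure q ((1 - a) / S) p0 pS.
have unique mu : renewal q (rmass mu) -> rmass mu [:: true] = (1 - a) / S ->
    same_measure mu pi.
  move=> mun mup; apply: eq_rmass.
  apply: (renewal_unique q) => //; rewrite ?mup ?pip//;
    by [exact: rmass_nil|exact: rmass_rcons].
have zeros mu : renewal q (rmass mu) ->
    (mu [set constseq false] = a%:E <-> rmass mu [:: true] = (1 - a) / S).
  move=> mun.
  have <- : (fine (mu [set constseq false]))%:E = mu [set constseq false].
    by rewrite fineK// fin_num_measure//; exact: measurable_constseq.
  rewrite mass_zeros_convergent//; split=> [[e]|->].
    by rewrite -e opprB addrCA subrr addr0 mulfK// gt_eqF.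
  by rewrite divfK ?gt_eqF//; congr EFin; lra.
have pia := proj2 (zeros pi pin) pip.
have ones : a = 0 -> letter q (Some 0%N) false = 0 -> pi [set constseq true] = 1%E.
  move=> a0 q0; apply: mass_ones => //.
  by rewrite pip a0 limn_series1// subr0 divr1.
exists pi; split.
- split=> [|mu [/stationary_renewal[mun _] mua]].
    by split=> //; apply/stationary_renewal; rewrite pia /= aq.
  by apply: unique => //; apply/zeros.
- split=> [|mu [mup _ _ /formula3_renewal mun]]; last exact: unique.
  by have [? ? ?] := renewal_formulas q pi pin; split.
- split=> [/(trivial_rmass _ [:: true])|[a1|[a0 q0]]].
  + rewrite pip => -[|] /(congr1 ( *%R^~ S)); rewrite divfK ?gt_eqF//.
      by rewrite mul0r; left; lra.
    have := limn_series_ge; have := letter_ge0 q (Some 0%N) false.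
    by rewrite -/S mul1r => *; right; split; lra.
  + by apply: (trivial_mass1 pi false); rewrite pia a1.
  + by apply: (trivial_mass1 pi true); exact: ones.
- by move=> a1; apply: unique_mass1; rewrite pia a1.
- by move=> a0 q0; apply: unique_mass1; exact: ones.
Qed.

End convergent.

End stationary_law.

Theorem proposition23 (R : realType) (q : context -> probability bool R) :
  (letter q None false <> 1 ->
     ((exists pi : probability leftseq R, stationary q pi)
        <-> cvgn (series (comb_coef q)))
     /\
     (cvgn (series (comb_coef q)) ->
        exists pi : probability leftseq R,
          [/\ unique_measure (stationary q) pi,
              unique_measure (fun mu => [/\
                mass mu [:: true] = 1 / limn (series (comb_coef q)),
                formula1 q mu, formula2 q mu & formula3 q mu]) pi,
              trivial_measure pi <-> letter q (Some 0%N) false = 0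
            & letter q (Some 0%N) false = 0 ->
                unique_measure (fun mu => mu [set constseq true] = 1%E) pi]))
  /\
  (letter q None false = 1 ->
     (~ cvgn (series (comb_coef q)) ->
        exists pi : probability leftseq R,
          [/\ unique_measure (fun mu => mu [set constseq false] = 1%E) pi,
              trivial_measure pi
            & unique_measure (stationary q) pi])
     /\
     (cvgn (series (comb_coef q)) ->
        forall a : R, 0 <= a <= 1 ->
        exists pi : probability leftseq R,
          [/\ unique_measure (fun mu =>
                stationary q mu /\ mu [set constseq false] = a%:E) pi,
              unique_measure (fun mu => [/\
                mass mu [:: true] = (1 - a) / limn (series (comb_coef q)),
                formula1 q mu, formula2 q mu & formula3 q mu]) pi,
              trivial_measure pi <->
                (a = 1 \/ a = 0 /\ letter q (Some 0%N) false = 0),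
              (a = 1 ->
                unique_measure (fun mu => mu [set constseq false] = 1%E) pi)
            & (a = 0 -> letter q (Some 0%N) false = 0 ->
                unique_measure (fun mu => mu [set constseq true] = 1%E) pi)])).
Proof.
split=> q0.
  (* In the irreducible case a stationary measure cannot charge 0^oo. *)
  have nozero mu : stationary q mu -> fine (mu [set constseq false]) = 0.
    move=> /stationary_renewal[_] e; apply/eqP; apply: contrapT => /negP z0.
    by apply: q0; apply: (mulfI z0); rewrite -e mulr1.
  split=> [|cvS].
    split=> [[pi st]|cvS].
      apply: contrapT => dv; have [pin _] := proj1 (stationary_renewal q pi) st.
      have := mass_zeros_no_one _ _ pin (divergent_no_one _ _ pin dv).
      by rewrite nozero// => /esym/eqP; rewrite oner_eq0.
    have [||pi [[[st _] _] _ _ _ _]] := stationary_family q cvS 0.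
    - by rewrite lexx ler01.
    - by rewrite mul0r.
    - by exists pi.
  have [||pi [[[st _] uniq] fu tr _ ones]] := stationary_family q cvS 0.
  - by rewrite lexx ler01.
  - by rewrite mul0r.
  exists pi; split.
  - split=> // mu stm; apply: uniq; split=> //.
    rewrite -(nozero mu stm) fineK// fin_num_measure//; exact: measurable_constseq.
  - by move: fu; rewrite subr0.
  - rewrite tr; split=> [[/eqP|[]//]|]; last by right.
    by rewrite eq_sym oner_eq0.
  - exact: ones.
split=> [dv|cvS a a01]; last by apply: stationary_family => //; rewrite q0 mulr1.
(* The Dirac mass at 0^oo arises as the solution of the recursion with p = 0. *)
have [|n|pi [pin pip]] := exists_renewal_measure q 0.
- by [].
- by rewrite mul0r ler01.
have mass1 mu : renewal q (rmass mu) -> rmass mu [:: true] = 0 ->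
    mu [set constseq false] = 1%E.
  move=> mun mup; rewrite -(mass_zeros_no_one q mu mun mup) fineK//.
  by rewrite fin_num_measure//; exact: measurable_constseq.
have u1 := unique_mass1 pi false (mass1 pi pin pip).
exists pi; split=> //; first exact: trivial_mass1 (mass1 pi pin pip).
split; first by apply/stationary_renewal; rewrite q0 mulr1.
move=> mu /stationary_renewal[mun _]; apply: (proj2 u1).
by apply: mass1 => //; exact: (divergent_no_one q).
Qed.
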